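(* Let $L>0$, $0<c_1<1$, and let $U_0:[L,\infty)\to\mathbb{R}$ be supported in $(L,\infty)$. Then the solution $G:[0,\infty)\to\mathbb{R}$ of the functional equation $$G(t) = \frac{c_1}{c_1 +1}\, U_0 (L+t) - \frac{2}{c_1 +1} \sum_{n=1}^{\left[ \frac{c_1 t}{2L}\right] } G \left( t - \frac{2n L}{c_1} \right), \qquad t\geq 0,$$ is given by $$G(t) = \frac{c_1}{c_1 +1}\, U_0 (L+t) - \frac{2c_1}{(c_1 + 1)^2} \sum_{n=0}^{\left[ \frac{c_1 t}{2L}-1\right] } \frac{(c_1 - 1)^n}{(c_1 +1)^{n}}\, U_0 \left(L+ t - \frac{2(n+1) L}{c_1} \right), \qquad t \geq 0.$$
   Context: Here $[a]$ denotes the integer part (floor) of the real number $a$. Convention: if $0\le t<2L/c_1$, the sums in both displayed formulas contain no terms and are equal to $0$. The support assumption on $U_0$ includes $U_0(L)=0$ (compatibility condition). The constant $L$ is the length of a single-layered medium occupying $(0,L)$, $c_1$ is the wave speed in the medium (the speed outside is $1$), and $G(t)$ is the value of the wave at the boundary $x=L$ at time $t$. *)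

(* Defs.v *)
From mathcomp Require Import all_boot all_order all_algebra.
From mathcomp Require Import reals.

Set Implicit Arguments.
Unset Strict Implicit.
Unset Printing Implicit Defensive.

Import Order.TTheory GRing.Theory Num.Theory.

Local Open Scope ring_scope.

(* Sum over m <= n <= b, both ends included. The upper bound is an integer
   because a floor can be -1; the sum is then empty. *)
Definition sum_upto (R : nmodType) (m : nat) (b : int) (F : nat -> R) : R :=
  match b with
  | Posz k => \sum_(m <= n < k.+1) F n
  | Negz _ => 0
  end.

(* Main.v *)
(* Put T = 2L/c1.  On each class r + TN with 0 <= r < T, both formulas have the
   form g_k = a u_k - b X_k, with a = c1/(c1+1) and b = 2/(c1+1): in the
   functional equation X_k is the partial sum of g, in the closed formula it is
   the convolution of a u with the powers of 1 - b.  Either formula makes the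
   partial sum and the convolution satisfy the same first-order recurrence with
   the same initial value, so they agree. *)

Require Import Defs.
From mathcomp Require Import all_boot all_order all_algebra.
From mathcomp Require Import reals.
From mathcomp Require Import ring.

Set Implicit Arguments.
Unset Strict Implicit.
Unset Printing Implicit Defensive.

Import Order.TTheory GRing.Theory Num.Theory.

Local Open Scope ring_scope.

Lemma partial_sum_convolution (R : comPzRingType) (a b : R) (g u : nat -> R) :
  (forall k, g k = a * u k - b * \sum_(j < k) g j) <->
  (forall k, g k = a * u k
                   - b * (a * \sum_(n < k) (1 - b) ^+ n * u (k - n.+1)%N)).
Proof.
pose v k := a * \sum_(n < k) (1 - b) ^+ n * u (k - n.+1)%N.
(* The term [n = 0] is [a * u k]; each later term carries one factor [1 - b] more than a term of
   [v k]. *)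
have vS k : v k.+1 = a * u k + (1 - b) * v k.
  rewrite /v big_ord_recl expr0 mul1r subn1 mulrDr /=; congr (_ + _).
  rewrite mulrCA; congr (_ * _); rewrite mulr_sumr.
  by apply: eq_bigr => i _; rewrite /bump add1n exprS mulrA subSS.
(* [w] stands for whichever of the two sums the assumed formula contains, so a single induction
   serves both directions. *)
suff sum_g w : (forall k, w k = \sum_(j < k) g j) \/ (forall k, w k = v k) ->
    (forall k, g k = a * u k - b * w k) -> forall k, \sum_(j < k) g j = v k.
  split=> gE k.
    rewrite {1}gE; congr (_ - _ * _).
    by apply: (sum_g (fun k => \sum_(j < k) g j)) => //; left.
  rewrite (sum_g v) //; by right.
move=> wE gE; elim=> [|k IHk]; first by rewrite /v !big_ord0 mulr0.
have wk : w k = v k by case: wE => ->.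
by rewrite big_ord_recr /= IHk vS gE wk; ring.
Qed.

(** Reversing the order by [n = k - j] turns the delayed values in the functional equation into a
    partial sum from the start of the class. *)
Lemma sum_upto1E (V : nmodType) (k : nat) (F : nat -> V) :
  sum_upto 1 k%:Z F = \sum_(j < k) F (k - j)%N.
Proof.
rewrite /= big_add1 big_mkord (reindex_inj rev_ord_inj) /=.
by apply: eq_bigr => i _; rewrite subnSK.
Qed.

Lemma sum_upto0_pred (V : nmodType) (k : nat) (F : nat -> V) :
  sum_upto 0 (k%:Z - 1) F = \sum_(n < k) F n.
Proof.
(* For [k = 0] the bound is -1, which falls in the [Negz] branch. *)
case: k => [|k]; first by rewrite big_ord0.
by rewrite -addn1 PoszD addrK /= big_mkord addn1.
Qed.

(** Division of [t] with remainder by [T]: the quotient is the truncation of [t / T]. *)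
Lemma forall_ge0_residue (R : archiRealFieldType) (T : R) (P : R -> Prop) :
  0 < T ->
  (forall t, 0 <= t -> P t) <->
  (forall r, 0 <= r < T -> forall k : nat, P (r + k%:R * T)).
Proof.
move=> T0; split=> [Pt r /andP[r0 _] k|Pr t t0].
  by apply: Pt; rewrite addr_ge0 // mulr_ge0 // ltW.
have /truncn_itv/andP[kt tk] : 0 <= t / T by rewrite divr_ge0 // ltW.
rewrite -(subrK ((Num.truncn (t / T))%:R * T) t).
apply: Pr; rewrite subr_ge0 -ler_pdivlMr // kt /=.
by move: tk; rewrite ltr_pdivrMr // -nat1r mulrDl mul1r ltrBlDr.
Qed.

Theorem theorem2p1 (R : realType) (L c1 : R) (U0 : R -> R)
    (L_gt0 : 0 < L) (c1_gt0 : 0 < c1) (c1_lt1 : c1 < 1)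
    (U0_supp : forall x : R, L <= x -> U0 x != 0 -> L < x)
    (G : R -> R) :
  (forall t : R, 0 <= t ->
     G t = c1 / (c1 + 1) * U0 (L + t)
           - 2 / (c1 + 1)
             * sum_upto 1 (Num.floor (c1 * t / (2 * L)))
                 (fun n => G (t - 2 * n%:R * L / c1)))
  <->
  (forall t : R, 0 <= t ->
     G t = c1 / (c1 + 1) * U0 (L + t)
           - 2 * c1 / (c1 + 1) ^+ 2
             * sum_upto 0 (Num.floor (c1 * t / (2 * L) - 1))
                 (fun n => (c1 - 1) ^+ n / (c1 + 1) ^+ n
                           * U0 (L + t - 2 * n.+1%:R * L / c1))).
Proof.
pose T := 2 * L / c1.
have c1N0 : c1 != 0 by rewrite gt_eqF.
have LN0 : L != 0 by rewrite gt_eqF.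
have c1DN0 : c1 + 1 != 0 by rewrite gt_eqF // addr_gt0.
have T0 : 0 < T by rewrite divr_gt0 // mulr_gt0.
have floorE r (k : nat) :
    0 <= r < T -> Num.floor (c1 * (r + k%:R * T) / (2 * L)) = k%:Z.
  move=> /andP[r0 rT]; apply: floor_def.
  (* Here [r / T] lies in [0, 1), so the floor is exactly [k]. *)
  have -> : c1 * (r + k%:R * T) / (2 * L) = k%:R + r / T.
    by rewrite /T; field; rewrite LN0 c1N0.
  rewrite intrD -!pmulrn lerDl ltrD2l divr_ge0 ?(ltW T0) //=.
  by rewrite ltr_pdivrMr // mul1r.
have qE : 1 - 2 / (c1 + 1) = (c1 - 1) / (c1 + 1) by field.
have eqn1 r k : 0 <= r < T ->
    sum_upto 1 (Num.floor (c1 * (r + k%:R * T) / (2 * L)))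
      (fun n => G (r + k%:R * T - 2 * n%:R * L / c1))
    = \sum_(j < k) G (r + j%:R * T).
  move=> rT; rewrite floorE // sum_upto1E; apply: eq_bigr => j _.
  by rewrite natrB 1?ltnW //; congr G; rewrite /T; field.
have eqn2 r k : 0 <= r < T ->
    2 * c1 / (c1 + 1) ^+ 2
    * sum_upto 0 (Num.floor (c1 * (r + k%:R * T) / (2 * L) - 1))
        (fun n => (c1 - 1) ^+ n / (c1 + 1) ^+ n
                  * U0 (L + (r + k%:R * T) - 2 * n.+1%:R * L / c1))
    = 2 / (c1 + 1) * (c1 / (c1 + 1) *
        \sum_(n < k) (1 - 2 / (c1 + 1)) ^+ n
                     * U0 (L + (r + (k - n.+1)%N%:R * T))).
  move=> rT; rewrite floorDrz ?rpredN1 // (intrKfloor (- 1)) floorE // sum_upto0_pred.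
  (* The outer constant of the closed formula is the product of [b] and [a], and by [qE] its ratio
     is [1 - b]. *)
  rewrite [RHS]mulrA; congr (_ * _); first by field.
  apply: eq_bigr => n _; rewrite qE expr_div_n; congr (_ * U0 _).
  (* Since [n < k], the natural subtraction [k - n.+1] does not truncate. *)
  by rewrite natrB // /T; field.
rewrite !(forall_ge0_residue _ T0).
have conv r := partial_sum_convolution (c1 / (c1 + 1)) (2 / (c1 + 1))
  (fun k => G (r + k%:R * T)) (fun k => U0 (L + (r + k%:R * T))).
split=> GE r rT k.
  (* The class [r] stays fixed while [k] is generalized, as [conv] needs the formula along the whole
     class. *)
  rewrite eqn2 //; apply: (conv r).1 => {}k.
  by rewrite -eqn1 //; apply: GE.
rewrite eqn1 //; apply: (conv r).2 => {}k.
by rewrite -eqn2 //; apply: GE.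
Qed.
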